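(* Every finite additive metric space has generalized roundness $> 1$.
   Context: A metric $d$ on a set $X$ is additive if for all $x,y,z,w \in X$ we have $d(x,y) + d(z,w) \le \max\{d(x,z) + d(y,w),\, d(x,w) + d(y,z)\}$. A real number $p \ge 0$ is a generalized roundness exponent of a metric space $(X,d)$ if for all integers $n > 0$ and all choices of (not necessarily distinct) points $a_1, \ldots, a_n, b_1, \ldots, b_n \in X$ we have $\sum_{1 \le k < l \le n} \{ d(a_k,a_l)^p + d(b_k,b_l)^p \} \le \sum_{1 \le j,i \le n} d(a_j,b_i)^p$. The generalized roundness of $(X,d)$ is the supremum (in $[0,\infty]$, possibly $\infty$) of the set of all generalized roundness exponents of $(X,d)$. For $p=0$ the convention $0^0 = 0$ is used for distances. *)

(* Defs.v *)
From HB Require Import structures.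
From mathcomp Require Import all_boot all_order all_algebra.
From mathcomp Require Import all_classical all_reals all_analysis.

Set Implicit Arguments.
Unset Strict Implicit.
Unset Printing Implicit Defensive.

Import Order.TTheory GRing.Theory Num.Theory.

Local Open Scope classical_set_scope.
Local Open Scope ring_scope.

Definition additive_metric (R : realType) (X : metricType R) : Prop :=
  forall x y z w : X,
    mdist x y + mdist z w
      <= Num.max (mdist x z + mdist y w) (mdist x w + mdist y z).

(* [powR] has [0 `^ 0 = 1], whereas the convention for distances is 0^0 = 0;
   the two agree at all other nonnegative exponents. *)
Definition dist_pow (R : realType) (X : metricType R) (p : R) (x y : X) : R :=
  if mdist x y == 0 then 0 else mdist x y `^ p.

Definition gen_roundness_exponent (R : realType) (X : metricType R) (p : R)
    : Prop :=
  0 <= p /\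
  forall (n : nat) (a b : 'I_n -> X), (0 < n)%N ->
    \sum_(k < n) \sum_(l < n | (k < l)%N)
        (dist_pow p (a k) (a l) + dist_pow p (b k) (b l))
      <= \sum_(j < n) \sum_(i < n) dist_pow p (a j) (b i).

Definition gen_roundness (R : realType) (X : metricType R) : \bar R :=
  ereal_sup [set p%:E | p in [set p : R | gen_roundness_exponent X p]].

(* Main.v *)
Require Import Defs.
From HB Require Import structures.
From mathcomp Require Import all_boot all_order all_algebra.
From mathcomp Require Import all_classical all_reals all_analysis.
From mathcomp Require Import ring lra.

(** Fix a base point [r].  For an additive metric [d], the Gromov product
    [(x | y) = (d x r + d y r - d x y) / 2] satisfies
    [(x | y) >= min (x | z) (z | y)]: this is the four-point condition with
    [r] as fourth point.  Such a kernel is a nonnegative combination of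
    indicators of partial equivalence relations, one for each of its superlevel
    sets, so its quadratic form is nonnegative ([qform_ultrametric_ge0]).

    Away from [r] the form is even bounded below by [c * \sum_x xi x ^+ 2] for
    some [c > 0] ([qform_ultrametric_coercive]).  The point [a] of the support
    farthest from [r] has [(a | x) < (a | a)] for all other [x], so a little of
    the diagonal entry at [a] can be removed without destroying the ultrametric
    inequality; the form therefore controls [xi a ^+ 2], and the remaining
    points are handled by induction.

    Coercivity survives a small perturbation of the kernel.  Since there are
    finitely many distances, [d ^ p] is uniformly close to [d] for [p > 1] close
    to [1], so the kernel built from [d ^ p] still has a nonnegative form
    ([qform_perturb_ge0], [dist_pow_exponent_close]).  On weights of sum zero,
    that form is [-1/2] times the form of [d ^ p] ([qform_gromov]); and the
    generalized roundness inequality for two families of points is nonpositivity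
    of the latter at the weight counting occurrences in the first family minus
    occurrences in the second ([roundness_of_qform]).  Hence this [p > 1] is a
    generalized roundness exponent. *)

Local Open Scope classical_set_scope.
Local Open Scope ring_scope.

Set Implicit Arguments.
Unset Strict Implicit.
Import Order.TTheory GRing.Theory Num.Theory.
Import numFieldNormedType.Exports.

(** * Quadratic forms of kernels *)

Definition qform (R : realFieldType) (T : finType) (K : T -> T -> R)
    (xi : T -> R) : R :=
  \sum_x \sum_y xi x * xi y * K x y.

Lemma eq_qform (R : realFieldType) (T : finType) (K L : T -> T -> R)
    (xi psi : T -> R) :
  (forall x y, xi x * xi y * K x y = psi x * psi y * L x y) ->
  qform K xi = qform L psi.
Proof. by move=> E; apply: eq_bigr => x _; apply: eq_bigr => y _. Qed.

Lemma qformD (R : realFieldType) (T : finType) (K L : T -> T -> R)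
    (xi : T -> R) :
  qform (fun x y => K x y + L x y) xi = qform K xi + qform L xi.
Proof.
rewrite /qform -big_split; apply: eq_bigr => x _.
by rewrite -big_split; apply: eq_bigr => y _; rewrite mulrDr.
Qed.

Lemma qformZ (R : realFieldType) (T : finType) (c : R) (K : T -> T -> R)
    (xi : T -> R) :
  qform (fun x y => c * K x y) xi = c * qform K xi.
Proof.
rewrite /qform mulr_sumr; apply: eq_bigr => x _.
by rewrite mulr_sumr; apply: eq_bigr => y _; rewrite mulrCA.
Qed.

Lemma qform_parallelogram (R : realFieldType) (T : finType)
    (K : T -> T -> R) (u v : T -> R) :
  qform K (fun x => u x + v x) + qform K (fun x => u x - v x)
  = 2 * qform K u + 2 * qform K v.
Proof.
rewrite /qform !mulr_sumr -!big_split; apply: eq_bigr => x _ /=.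
rewrite !mulr_sumr -!big_split; apply: eq_bigr => y _ /=; ring.
Qed.

Lemma qform_pointmass (R : realFieldType) (T : finType) (K : T -> T -> R)
    (a : T) (xi : T -> R) :
  (forall x, x != a -> xi x = 0) -> qform K xi = xi a ^+ 2 * K a a.
Proof.
move=> xi0; rewrite /qform (bigD1 a)//= [X in _ + X]big1 ?addr0; last first.
  by move=> x xa; apply: big1 => y _; rewrite xi0// !mul0r.
rewrite (bigD1 a)//= [X in _ + X]big1 ?addr0//.
by move=> y ya; rewrite (xi0 y)// mulr0 mul0r.
Qed.

(** * Ultrametric kernels *)

(** Writes the indicator of a partial equivalence as a sum of rank-one kernels:
    when [e x y] holds, the [z] that contribute are the members of the common
    class of [x] and [y], each with weight the inverse of its size.  The empty
    classes, where the division is by [0], contribute [0]. *)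
Lemma per_kernelE (R : realFieldType) (T : finType) (e : rel T) (x y : T) :
  symmetric e -> transitive e ->
  (e x y)%:R = \sum_z (e z x)%:R * (e z y)%:R / #|e z|%:R :> R.
Proof.
move=> sym_e tr_e; case exy : (e x y).
  rewrite (eq_bigr (fun z => if e x z then #|e x|%:R^-1 else 0 : R)).
    rewrite -big_mkcond sumr_const -[LHS](@mulVf _ #|e x|%:R) ?mulr_natr//.
    by rewrite pnatr_eq0 -lt0n; apply/card_gt0P; exists y.
  move=> z _; rewrite -(sym_e x z); case exz : (e x z); last by rewrite !mul0r.
  have -> : #|e z| = #|e x|.
    apply: eq_card => w; rewrite /in_mem /=; apply/idP/idP; first exact: tr_e.
    by apply: tr_e; rewrite sym_e.
  by rewrite (tr_e x)// 1?sym_e// !mul1r.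
rewrite big1// => z _.
case ezx : (e z x); last by rewrite !mul0r.
case ezy : (e z y); last by rewrite mulr0 mul0r.
by rewrite (tr_e z) // sym_e in exy.
Qed.

Lemma qform_per_ge0 (R : realFieldType) (T : finType) (e : rel T)
    (xi : T -> R) :
  symmetric e -> transitive e -> 0 <= qform (fun x y => (e x y)%:R) xi.
Proof.
move=> sym_e tr_e.
have -> : qform (fun x y => (e x y)%:R) xi
          = \sum_z (\sum_x (e z x)%:R * xi x) ^+ 2 / #|e z|%:R.
  transitivity (\sum_x \sum_z \sum_y
      ((e z x)%:R * xi x) * ((e z y)%:R * xi y) / #|e z|%:R).
    apply: eq_bigr => x _; rewrite exchange_big; apply: eq_bigr => y _ /=.
    rewrite (per_kernelE R x y sym_e tr_e) mulr_sumr.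
    by apply: eq_bigr => z _; ring.
  rewrite exchange_big; apply: eq_bigr => z _ /=.
  rewrite expr2 !mulr_suml; apply: eq_bigr => x _.
  by rewrite mulr_sumr mulr_suml.
by apply: sumr_ge0 => z _; rewrite divr_ge0// sqr_ge0.
Qed.

(** The third clause is [Num.min (K x z) (K z y) <= K x y], in the disjunctive
    form that linear arithmetic can consume. *)
Definition ultrametric_kernel (R : realFieldType) (T : finType)
    (K : T -> T -> R) : Prop :=
  [/\ forall x y, K x y = K y x,
      forall x y, 0 <= K x y
    & forall x y z, K x z <= K x y \/ K z y <= K x y].

(** Layer by layer: if [m] is the least positive value of [K], positivity of [K]
    is a partial equivalence relation, and subtracting [m] times its indicator
    leaves an ultrametric kernel with fewer positive entries. *)
Lemma qform_ultrametric_ge0 (R : realFieldType) (T : finType)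
    (K : T -> T -> R) (xi : T -> R) :
  ultrametric_kernel K -> 0 <= qform K xi.
Proof.
have [n] := ubnP #|[pred p : T * T | 0 < K p.1 p.2]|.
elim: n K => // n IHn K; rewrite ltnS => leKn [symK K_ge0 ultraK].
have [[x0 y0] /= K0|noK] := pickP (fun p => 0 < K p.1 p.2); last first.
  suff -> : qform K xi = 0 by [].
  apply: big1 => x _; apply: big1 => y _.
  have := noK (x, y); rewrite /= lt0r K_ge0 andbT => /negPn/eqP ->.
  by rewrite mulr0.
have [[a b] /= Kab minab] :=
  @arg_minP _ _ _ (x0, y0) (fun p => 0 < K p.1 p.2) (fun p => K p.1 p.2) K0.
have {minab} minK x y : 0 < K x y -> K a b <= K x y.
  by move=> Kxy; have := minab (x, y) Kxy.
pose e : rel T := fun x y => 0 < K x y.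
pose L x y := K x y - K a b * (e x y)%:R.
have LE x y : (0 < K x y /\ L x y = K x y - K a b) \/ (K x y = 0 /\ L x y = 0).
  rewrite /L /e; case: (ltrP 0 (K x y)) => [Kxy|Kxy] /=.
    by left; rewrite mulr1.
  have K0' : K x y = 0 by apply/eqP; rewrite eq_le Kxy K_ge0.
  by right; rewrite K0' mulr0 subr0.
have -> : qform K xi = qform L xi + K a b * qform (fun x y => (e x y)%:R) xi.
  rewrite -qformZ -qformD; apply: eq_qform => x y.
  by rewrite /L subrK.
apply: addr_ge0; last first.
  apply: mulr_ge0; first exact: ltW.
  apply: qform_per_ge0 => [x y|y x z]; rewrite /e; first by rewrite symK.
  by move=> Kxy Kyz; case: (ultraK x z y); apply: lt_le_trans.
apply: IHn.
  apply: leq_trans leKn; apply: proper_card; apply/properP; split.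
    apply/fintype.subsetP => -[x y]; rewrite !inE /=.
    by case: (LE x y) => -[Kxy ->]; rewrite ?ltxx.
  exists (a, b); rewrite !inE //=.
  by case: (LE a b) => -[_ ->]; rewrite ?subrr ltxx.
split=> [x y|x y|x y z].
- by rewrite /L /e symK.
- by case: (LE x y) => -[Kxy ->] //; rewrite subr_ge0 minK.
- case: (LE x y) (ultraK x y z) => -[Kxy ->];
  case: (LE x z) => -[Kxz ->]; case: (LE z y) => -[Kzy ->];
  by move: (minK x y); move=> mK [?|?]; (try have := mK Kxy); lra.
Qed.

(** Positive definiteness made quantitative by induction on the support, without
    compactness.  The strictness hypothesis only compares [K x y] with the larger
    of the two diagonal entries, because for Gromov products [K x y = K x x]
    does occur: it says that [x] lies between [r] and [y]. *)
Lemma qform_ultrametric_coercive (R : realFieldType) (T : finType)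
    (K : T -> T -> R) (S : {set T}) :
  ultrametric_kernel K ->
  {in S, forall x, 0 < K x x} ->
  {in S &, forall x y, x != y -> K y y <= K x x -> K x y < K x x} ->
  exists2 c, 0 < c & forall xi : T -> R, (forall x, x \notin S -> xi x = 0) ->
    c * \sum_x xi x ^+ 2 <= qform K xi.
Proof.
move=> ultraK.
have [n] := ubnP #|S|.
elim: n S => // n IHn S; rewrite ltnS => leSn Kgt0 Klt.
have [x0 x0S|S0] := pickP (mem S); last first.
  exists 1 => // xi xi0; rewrite big1 ?mulr0 ?qform_ultrametric_ge0//.
  by move=> x _; rewrite xi0 ?expr0n//; apply/negPf/S0.
have [a aS amax] := @arg_maxP _ _ _ x0 (mem S) (fun x => K x x) x0S.
change (is_true (a \in S)) in aS.
pose eps := \big[Num.min/K a a]_(z in S :\ a) (K a a - K a z).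
have eps_gt0 : 0 < eps.
  apply: lt_bigmin => [|z]; first exact: Kgt0.
  by rewrite !inE => /andP[za zS]; rewrite subr_gt0 Klt// 1?eq_sym//; apply: amax.
have eps_a : eps <= K a a by exact: bigmin_le_id.
have eps_z z : z \in S -> z != a -> K a z <= K a a - eps.
  move=> zS za; rewrite lerBrDr addrC -lerBrDr.
  by apply: bigmin_le_cond; rewrite !inE za.
have coercive_a (xi : T -> R) : (forall x, x \notin S -> xi x = 0) ->
    eps * xi a ^+ 2 <= qform K xi.
  move=> xi0.
  (* [H] is [K] restricted to [S], with [eps] removed at [(a, a)]; it is again
     ultrametric because [eps] is at most the gap between [K a a] and the rest
     of its row. *)
  pose D x y : R := ((x == a) && (y == a))%:R.
  pose H x y := if (x \in S) && (y \in S) then K x y - eps * D x y else 0.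
  have KE : qform K xi = qform H xi + eps * qform D xi.
    rewrite -qformZ -qformD; apply: eq_qform => x y; rewrite /H.
    have [xS|/xi0 ->] := boolP (x \in S); last by rewrite !mul0r.
    have [yS|/xi0 ->] := boolP (y \in S); last by rewrite mulr0 !mul0r.
    by rewrite subrK.
  have DE : qform D xi = xi a ^+ 2.
    rewrite -[RHS]mulr1.
    rewrite (@eq_qform _ _ _ D _ (fun x => if x == a then xi x else 0));
      last first.
      by move=> x y; rewrite /D; do 2 case: eqP => _; rewrite /= ?mulr0.
    by rewrite (qform_pointmass _ (a := a)) ?eqxx /D ?eqxx // => x /negPf ->.
  rewrite KE DE lerDr.
  case: ultraK => symK K_ge0 ultraK.
  apply: qform_ultrametric_ge0; split=> [x y|x y|x y z].
  - by rewrite /H /D symK [(x \in S) && _]andbC [(x == a) && _]andbC.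
  - rewrite /H; case: ifP => // _; rewrite /D.
    have [->|] := eqVneq x a; have [->|] := eqVneq y a => *;
      by rewrite /= ?mulr1 ?mulr0 ?subr0 ?subr_ge0.
  - have HK u v : H u v <= K u v.
      rewrite /H; case: ifP => _ //; rewrite gerBl mulr_ge0//; exact: ltW.
    have [xyS|nxyS] := boolP ((x \in S) && (y \in S)); last first.
      move: nxyS; rewrite negb_and /H => /orP[]/negPf ->; rewrite ?andbF /=.
        by left.
      by right.
    have [/andP[/eqP -> /eqP ->]|xya] := boolP ((x == a) && (y == a)).
      have [->|za] := eqVneq z a; first by left.
      left; rewrite /H /D eqxx aS (negPf za) /= mulr1.
      case: ifP => [zS|_]; last by rewrite subr_ge0.
      by rewrite mulr0 subr0 eps_z.
    have -> : H x y = K x y by rewrite /H xyS /D (negPf xya) mulr0 subr0.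
    by case: (ultraK x y z) => KK; [left|right]; apply: le_trans KK.
have [|x xSa|x y xSa ySa|c c_gt0 coercive_S] := IHn (S :\ a).
- by rewrite (cardsD1 a S) aS in leSn.
- by apply: Kgt0; case/setD1P: xSa.
- by apply: Klt; [case/setD1P: xSa|case/setD1P: ySa].
have Ka_gt0 : 0 < K a a by exact: Kgt0.
(* With [off] the weight [xi] erased at [a], the parallelogram law gives
   [qform K off <= 2 * qform K xi + 2 * xi a ^+ 2 * K a a]; bounding
   [xi a ^+ 2] by [qform K xi / eps] here, and the sum of squares of [off] by
   [qform K off / c], yields the constant [C]. *)
pose C := eps^-1 + (2 + 2 * K a a / eps) / c.
have C_gt0 : 0 < C.
  by rewrite addr_gt0 ?invr_gt0// divr_gt0// addr_gt0// divr_gt0// mulr_gt0.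
exists C^-1; first by rewrite invr_gt0.
move=> xi xi0; rewrite mulrC ler_pdivrMr // mulrC.
pose off x := if x == a then 0 else xi x.
pose at_a x := if x == a then xi x else 0.
have Qxi := coercive_a xi xi0.
have Qoff : c * \sum_x off x ^+ 2 <= qform K off.
  apply: coercive_S => x; rewrite !inE negb_and negbK /off.
  by case: eqP => //= _ /xi0.
have sumE : \sum_x xi x ^+ 2 = xi a ^+ 2 + \sum_x off x ^+ 2.
  rewrite (bigD1 a)//= [X in _ = _ + X](bigD1 a)//= {1}/off eqxx expr0n add0r.
  by congr (_ + _); apply: eq_bigr => x /negPf xa; rewrite /off xa.
have Qat : qform K at_a = xi a ^+ 2 * K a a.
  by rewrite (qform_pointmass _ (a := a)) /at_a ?eqxx// => x /negPf ->.
have par : qform K off <= 2 * qform K xi + 2 * qform K at_a.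
  rewrite -qform_parallelogram.
  have -> : qform K off = qform K (fun x => xi x - at_a x).
    apply: eq_qform => x y; rewrite /off /at_a.
    by do 2 case: eqP => _; rewrite ?subrr ?subr0.
  by rewrite lerDr qform_ultrametric_ge0.
have xia : xi a ^+ 2 <= qform K xi / eps by rewrite ler_pdivlMr// mulrC.
have xiaK : xi a ^+ 2 * K a a <= qform K xi / eps * K a a.
  by rewrite ler_wpM2r// ltW.
rewrite sumE /C mulrDl; apply: lerD; first by rewrite mulrC.
rewrite mulrAC ler_pdivlMr// mulrC; apply: (le_trans Qoff); apply: (le_trans par).
rewrite Qat; have -> : (2 + 2 * K a a / eps) * qform K xi
  = 2 * qform K xi + 2 * (qform K xi / eps * K a a) by ring.
by rewrite lerD2l ler_pM2l.
Qed.

(** * Perturbation *)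

(** An entrywise error [eta] changes the form by at most
    [eta * (\sum_x `|xi x|) ^+ 2], hence by at most
    [eta * #|T| * \sum_x xi x ^+ 2]. *)
Lemma qform_perturb_ge0 (R : realFieldType) (T : finType)
    (K L : T -> T -> R) (xi : T -> R) (c eta : R) :
  c * \sum_x xi x ^+ 2 <= qform K xi ->
  (forall x y, `|L x y - K x y| <= eta) -> eta * #|T|%:R <= c ->
  0 <= qform L xi.
Proof.
move=> cK dKL etac.
have -> : qform L xi = qform K xi + qform (fun x y => L x y - K x y) xi.
  by rewrite -qformD; apply: eq_qform => x y; rewrite addrC subrK.
rewrite -lerBlDr sub0r; apply: le_trans cK.
apply: (@le_trans _ _ (eta * #|T|%:R * \sum_x xi x ^+ 2)); last first.
  by apply: ler_wpM2r => //; apply: sumr_ge0 => x _; apply: sqr_ge0.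
have -> : eta * #|T|%:R * \sum_x xi x ^+ 2
    = \sum_x \sum_y eta * ((xi x ^+ 2 + xi y ^+ 2) / 2).
  transitivity (eta / 2 * \sum_x \sum_y (xi x ^+ 2 + xi y ^+ 2)).
    under [in RHS]eq_bigr do rewrite big_split sumr_const /=.
    rewrite big_split /= sumr_const sumrMnl -mulr_natr; by field.
  rewrite mulr_sumr; apply: eq_bigr => x _.
  by rewrite mulr_sumr; apply: eq_bigr => y _; field.
rewrite /qform -sumrN; apply: ler_sum => x _.
rewrite -sumrN; apply: ler_sum => y _.
apply: le_trans (ler_norm _) _; rewrite normrN normrM mulrC.
apply: ler_pM => //.
rewrite normrM.
have := sqr_ge0 (`|xi x| - `|xi y|); rewrite sqrrB !real_normK ?num_real//; lra.
Qed.

(** * Gromov products *)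

Definition gromov (R : realFieldType) (T : Type) (D : T -> T -> R)
    (r x y : T) : R := (D x r + D y r - D x y) / 2.

(** The terms [D x r] and [D y r] depend on one variable only, so they vanish
    against a weight of sum zero. *)
Lemma qform_gromov (R : realFieldType) (T : finType) (D : T -> T -> R)
    (r : T) (xi : T -> R) :
  \sum_x xi x = 0 -> qform D xi = - (2 * qform (gromov D r) xi).
Proof.
move=> xi0; rewrite -mulNr -qformZ.
pose h x := D x r.
have -> : qform D xi = qform (fun x y => -2 * gromov D r x y) xi
    + (qform (fun x _ => h x) xi + qform (fun _ y => h y) xi).
  by rewrite -!qformD; apply: eq_qform => x y; rewrite /gromov /h; field.
have -> : qform (fun x _ => h x) xi = 0.
  apply: big1 => x _.
  by under eq_bigr do rewrite mulrAC; rewrite -mulr_sumr xi0 mulr0.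
have -> : qform (fun _ y => h y) xi = 0.
  rewrite /qform exchange_big; apply: big1 => y _.
  by under eq_bigr do rewrite -mulrA; rewrite -mulr_suml xi0 mul0r.
by rewrite !addr0.
Qed.

(** * From quadratic forms to roundness *)

Definition charge (R : realFieldType) (T : finType) (n : nat)
    (a b : 'I_n -> T) (x : T) : R :=
  \sum_k ((a k == x)%:R - (b k == x)%:R).

Lemma sum_chargeM (R : realFieldType) (T : finType) (n : nat)
    (a b : 'I_n -> T) (F : T -> R) :
  \sum_x charge R a b x * F x = \sum_k (F (a k) - F (b k)).
Proof.
under eq_bigr do rewrite /charge mulr_suml.
rewrite exchange_big; apply: eq_bigr => k _ /=.
have pick z : \sum_x (z == x)%:R * F x = F z.
  rewrite (bigD1 z)//= eqxx mul1r big1 ?addr0// => x /negPf.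
  by rewrite eq_sym => ->; rewrite mul0r.
by under eq_bigr do rewrite mulrBl; rewrite sumrB !pick.
Qed.

Lemma sum_ltn_ord (R : realFieldType) (n : nat) (F : 'I_n -> 'I_n -> R) :
  (forall k l, F k l = F l k) -> (forall k, F k k = 0) ->
  \sum_k \sum_l F k l = 2 * \sum_(k < n) \sum_(l < n | (k < l)%N) F k l.
Proof.
move=> symF F0.
have split_row (k : 'I_n) : \sum_l F k l
    = \sum_(l < n | (k < l)%N) F k l + \sum_(l < n | (l < k)%N) F k l.
  rewrite (bigID (fun l : 'I_n => (k < l)%N))/=; congr (_ + _).
  rewrite (bigD1 k) ?ltnn//= F0 add0r; apply: eq_bigl => l.
  by rewrite -leqNgt ltn_neqAle andbC.
under eq_bigr do rewrite split_row.
rewrite big_split /= mulr2n mulrDl !mul1r; congr (_ + _).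
under eq_bigr do rewrite big_mkcond.
under [RHS]eq_bigr do rewrite big_mkcond.
by rewrite exchange_big; do 2 (apply: eq_bigr => ? _); rewrite /= symF.
Qed.

(** Expanding the form at [charge R a b] gives the double sums over the [a]s and
    over the [b]s minus twice the mixed sum; by symmetry each of the first two
    is twice its part above the diagonal. *)
Lemma roundness_of_qform (R : realFieldType) (T : finType)
    (D : T -> T -> R) (n : nat) (a b : 'I_n -> T) :
  (forall x y, D x y = D y x) -> (forall x, D x x = 0) ->
  qform D (charge R a b) <= 0 ->
  \sum_(k < n) \sum_(l < n | (k < l)%N) (D (a k) (a l) + D (b k) (b l))
    <= \sum_(j < n) \sum_(i < n) D (a j) (b i).
Proof.
move=> symD D0.
have -> : qform D (charge R a b)
  = \sum_k \sum_l (D (a k) (a l) + D (b k) (b l))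
    - 2 * \sum_k \sum_l D (a k) (b l).
  rewrite /qform.
  under eq_bigr do under eq_bigr do rewrite -mulrA.
  under eq_bigr do rewrite -mulr_sumr sum_chargeM.
  rewrite sum_chargeM.
  have -> : \sum_k (\sum_l (D (a k) (a l) - D (a k) (b l))
                    - \sum_l (D (b k) (a l) - D (b k) (b l)))
    = \sum_k \sum_l (D (a k) (a l) + D (b k) (b l))
      - \sum_k \sum_l D (a k) (b l) - \sum_k \sum_l D (b k) (a l).
    rewrite -!sumrB; apply: eq_bigr => k _.
    by rewrite -!sumrB; apply: eq_bigr => l _; ring.
  rewrite [X in _ - _ - X]exchange_big mulr2n mulrDl mul1r opprD addrA.
  by congr (_ - _); do 2 (apply: eq_bigr => ? _); rewrite symD.
rewrite (sum_ltn_ord (F := fun k l => D (a k) (a l) + D (b k) (b l))).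
- by rewrite -mulrBr pmulr_rle0// subr_le0.
- by move=> k l; rewrite symD [D (b k) _]symD.
- by move=> k; rewrite !D0 addr0.
Qed.

(** * Additive metrics *)

Lemma gromov_ultrametric (R : realType) (X : metricType R) (T : finType)
    (f : T -> X) (r : T) :
  additive_metric X ->
  ultrametric_kernel (gromov (fun s t => mdist (f s) (f t)) r).
Proof.
move=> addX; split=> [x y|x y|x y z]; rewrite /gromov.
- by rewrite (metric_sym (f x) (f y)) [mdist (f y) (f r) + _]addrC.
- have := metric_triangle (f x) (f r) (f y).
  rewrite (metric_sym (f r) (f y)); lra.
- have := addX (f x) (f y) (f z) (f r); rewrite le_max.
  rewrite (metric_sym (f z) (f y)).
  by case/orP => ?; [left|right]; lra.
Qed.

Lemma powR_exponent_cvg1 (R : realType) (d : R) :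
  0 < d -> (d `^ p @[p --> 1^'+] --> d)%classic.
Proof.
move=> d0; rewrite -[X in _ --> X](powRr1 (ltW d0)).
apply: cvg_at_right_filter.
rewrite /powR gt_eqF//.
apply: (@cvg_comp _ _ _ (fun p => p * ln d) expR); last exact: continuous_expR.
by apply: cvgMl; exact: cvg_id.
Qed.

(** Each distance is a continuous function of the exponent; as the pairs are
    finitely many, a single [p] serves all of them. *)
Lemma dist_pow_exponent_close (R : realType) (X : metricType R) (T : finType)
    (f : T -> X) (eta : R) :
  0 < eta -> exists2 p, 1 < p &
    forall s t, `|dist_pow p (f s) (f t) - mdist (f s) (f t)| <= eta.
Proof.
move=> eta0.
have close : \forall p \near 1^'+, forall st : T * T,
    `|dist_pow p (f st.1) (f st.2) - mdist (f st.1) (f st.2)| <= eta.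
  apply: filter_forall => -[s t] /=; rewrite /dist_pow.
  have [->|d0] := eqVneq (mdist (f s) (f t)) 0.
    by near=> p; rewrite subrr normr0 ltW.
  have d_gt0 : 0 < mdist (f s) (f t) by rewrite lt0r d0 mdist_ge0.
  by have /cvgr_distC_le/(_ eta eta0) := powR_exponent_cvg1 d_gt0.
have [p [p1 pclose]] := filter_ex (filterI (nbhs_right_gt (1 : R)) close).
by exists p => // s t; exact: (pclose (s, t)).
Unshelve. all: by end_near. Qed.

(** The maps [f] and [g] transport the problem from [X] to a [finType], where
    finite sums make sense. *)
Lemma finite_additive_exponent_gt1 (R : realType) (X : metricType R)
    (T : finType) (f : T -> X) (g : X -> T) (r : T) :
  cancel g f -> injective f -> additive_metric X ->
  exists2 p, 1 < p & gen_roundness_exponent X p.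
Proof.
move=> gK f_inj addX.
pose d s t := mdist (f s) (f t).
have dxx s : d s s = 0 by exact: mdistxx.
have d_sym s t : d s t = d t s by exact: metric_sym.
have d_gt0 s t : s != t -> 0 < d s t.
  by move=> st; rewrite mdist_gt0; apply: contra_neq st; exact: f_inj.
have Gxx s : gromov d r s s = d s r by rewrite /gromov dxx; field.
have [|s|s t sr tr st|c c_gt0 coercive] :=
    @qform_ultrametric_coercive R T (gromov d r) [set~ r]%SET.
- exact: gromov_ultrametric.
- by rewrite !inE Gxx => sr; exact: d_gt0.
- by rewrite !Gxx /gromov; have := d_gt0 _ _ st; lra.
have N_gt0 : 0 < #|T|%:R :> R by rewrite ltr0n; apply/card_gt0P; exists r.
pose eta := c / (2 * #|T|%:R).
have eta_gt0 : 0 < eta by rewrite divr_gt0// mulr_gt0.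
have [p p_gt1 close] := dist_pow_exponent_close f eta_gt0.
exists p => //; split=> [|n a b _]; first exact: ltW (lt_trans ltr01 p_gt1).
pose D s t := dist_pow p (f s) (f t).
have Dxx s : D s s = 0 by rewrite /D /dist_pow mdistxx eqxx.
have D_sym s t : D s t = D t s by rewrite /D /dist_pow metric_sym.
have -> : @dist_pow R X p = fun x y => D (g x) (g y).
  by apply/funext => x; apply/funext => y; rewrite /D !gK.
apply: (@roundness_of_qform R T D n (g \o a) (g \o b)) => //.
set xi := charge R _ _.
have xi_sum : \sum_t xi t = 0.
  under eq_bigr do rewrite -[xi _]mulr1.
  by rewrite sum_chargeM; under eq_bigr do rewrite subrr; exact: big1.
rewrite (qform_gromov D r xi_sum) oppr_le0 pmulr_rge0//.
(* Coercivity holds for weights vanishing at [r], whereas [xi] has sum zero;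
   erasing [xi r] is harmless since both Gromov kernels vanish on the row and
   column of [r]. *)
pose psi t := if t == r then 0 else xi t.
have -> : qform (gromov D r) xi = qform (gromov D r) psi.
  apply: eq_qform => s t; rewrite /psi.
  case: eqP => [->|_].
    by rewrite /gromov Dxx (D_sym t r) add0r subrr !mul0r mulr0.
  case: eqP => [->|_] //.
  by rewrite /gromov Dxx addr0 subrr !mul0r !mulr0 ?mul0r.
apply: (@qform_perturb_ge0 _ _ (gromov d r) _ _ c (2 * eta)).
(* A Gromov product combines three distances, halved: the error is at most
   [3 / 2 * eta]. *)
- by apply: coercive => t; rewrite !inE negbK /psi => ->.
- move=> s t; rewrite /gromov.
  have := close s r; have := close t r; have := close s t.
  rewrite -/(D _ _) -/(D _ _) -/(D _ _) -/(d _ _) -/(d _ _) -/(d _ _).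
  rewrite !ler_norml => /andP[? ?] /andP[? ?] /andP[? ?].
  by apply/andP; split; lra.
- by rewrite /eta le_eqVlt; apply/orP; left; apply/eqP; field; rewrite gt_eqF.
Qed.

Theorem corollary4p2 (R : realType) (X : metricType R)
    (finX : finite_set [set: X]) (addX : additive_metric X) :
  (1 < gen_roundness X)%E.
Proof.
suff [p p_gt1 p_exp] : exists2 p, 1 < p & gen_roundness_exponent X p.
  apply: (@lt_le_trans _ _ p%:E); first by rewrite lte_fin.
  by apply: ereal_sup_ubound; exists p.
(* Without points there is no base point, but then every nonnegative exponent
   is vacuously admissible. *)
have [[x0]|X0] := pselect (inhabited X); last first.
  exists 2; first by rewrite ltr1n.
  split=> // n a b n_gt0.
  by case: X0; exact: inhabits (a (Ordinal n_gt0)).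
have /finite_seqP[s sX] := finX.
have mem_s x : x \in s.
  by have : [set: X] x by []; rewrite sX.
apply: (@finite_additive_exponent_gt1 R X (seq_sub s) val
  (fun x => SeqSub (mem_s x)) (SeqSub (mem_s x0))) => //.
Qed.
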